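(* Let $G$ be a (4,6)-fullerene graph with $h$ hexagonal faces. Then $M(G,4)=\frac{27}{8}h^4+\frac{81}{4}h^3+\frac{273}{8}h^2+\frac{117}{4}h+9$, $M(G,5)=\frac{81}{40}h^5+\frac{27}{4}h^4-\frac{9}{8}h^3+\frac{39}{4}h^2-\frac{27}{5}h$, $M(G,6)=\frac{81}{80}h^6-\frac{81}{80}h^5-\frac{99}{16}h^4+\frac{405}{16}h^3-\frac{2833}{40}h^2-\frac{123}{10}h-16+\frac{N(Q)}{6}$.
   Context: A (4,6)-fullerene graph is a plane 3-regular graph all of whose faces are bounded by 4-cycles or 6-cycles, with exactly six square faces; $h$ is the number of hexagonal faces. $M(G,k)$ is the number of $k$-matchings (sets of $k$ pairwise nonadjacent edges) of $G$. $N(Q)$ is the number of (not necessarily induced) subgraphs of $G$ isomorphic to $Q$, the disjoint union of a path with 5 edges and one further edge. *)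

(* Defs.v *)
From mathcomp Require Import all_boot all_fingroup.

Set Implicit Arguments.
Unset Strict Implicit.
Unset Printing Implicit Defensive.

Record sgraph := SGraph {
  vertex :> finType;
  adj : rel vertex;
  adj_sym : symmetric adj;
  adj_irrefl : irreflexive adj }.

Definition edges (G : sgraph) : {set {set G}} :=
  [set [set p.1; p.2] | p : G * G & adj p.1 p.2].

Definition neighbours (G : sgraph) (x : G) : {set G} := [set y | adj x y].

Definition cubic (G : sgraph) : Prop := forall x : G, #|neighbours x| = 3.

Definition connected (G : sgraph) : Prop :=
  forall x y : G, connect (@adj G) x y.

(* M(G,k) *)
Definition matchings (G : sgraph) (k : nat) : {set {set {set G}}} :=
  [set S : {set {set G}} | [&& S \subset edges G, trivIset S & #|S| == k]].

Definition num_matchings (G : sgraph) (k : nat) : nat := #|matchings G k|.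

(* A subgraph is a pair (vertex set, edge set), not necessarily induced. *)
Definition is_subgraph (G : sgraph) (S : {set G} * {set {set G}}) : bool :=
  (S.2 \subset edges G) && [forall a in S.2, a \subset S.1].

Definition isomorphic_to (Q G : sgraph) (S : {set G} * {set {set G}}) : bool :=
  [exists f : {ffun Q -> G},
    [&& injectiveb f, S.1 == f @: [set: Q]
      & S.2 == [set f @: (a : {set Q}) | a in edges Q]]].

(* N(Q) *)
Definition num_subgraphs (Q G : sgraph) : nat :=
  #|[set S : {set G} * {set {set G}} | is_subgraph S && isomorphic_to Q S]|.

Section PathGraph.
Variable n : nat.

Definition path_adj : rel 'I_n := fun i j => (i.+1 == j) || (j.+1 == i).

Lemma path_adj_sym : symmetric path_adj.
Proof. by move=> i j; rewrite /path_adj orbC. Qed.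

Lemma path_adj_irrefl : irreflexive path_adj.
Proof. by move=> i; rewrite /path_adj orbb eqn_leq ltnn. Qed.

(* n vertices, hence n.-1 edges *)
Definition path_graph : sgraph := SGraph path_adj_sym path_adj_irrefl.
End PathGraph.

Section DisjointUnion.
Variables G H : sgraph.

Definition union_adj : rel (G + H)%type := fun u v =>
  match u, v with
  | inl x, inl y => adj x y
  | inr x, inr y => adj x y
  | _, _ => false
  end.

Lemma union_adj_sym : symmetric union_adj.
Proof. by move=> [x|x] [y|y] //=; rewrite adj_sym. Qed.

Lemma union_adj_irrefl : irreflexive union_adj.
Proof. by move=> [x|x] /=; rewrite adj_irrefl. Qed.

Definition disjoint_union : sgraph := SGraph union_adj_sym union_adj_irrefl.
End DisjointUnion.

Definition graphQ : sgraph := disjoint_union (path_graph 6) (path_graph 2).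

(* Plane graphs are represented, up to homeomorphism, by rotation systems of
   genus zero.  A dart is an oriented edge; the rotation at a vertex is the
   cyclic order in which the darts leaving it are met around it. *)
Definition dart (G : sgraph) := {d : G * G | adj d.1 d.2}.

Section Darts.
Variable G : sgraph.

Definition tail (d : dart G) : G := (val d).1.

Lemma rev_dart_proof (d : dart G) : adj (val d).2 (val d).1.
Proof. by rewrite adj_sym; exact: (valP d). Qed.

Definition rev_dart (d : dart G) : dart G :=
  exist (fun d : G * G => adj d.1 d.2) ((val d).2, (val d).1)
    (rev_dart_proof d).

Lemma rev_dart_inj : injective rev_dart.
Proof.
by move=> [[x y] p] [[x' y'] q] [ey ex]; apply: val_inj; rewrite /= ex ey.
Qed.

(* The dart following (x, y) along its face is the rotation of (y, x);
   (s * t)%g x is t (s x). *)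
Definition face_perm (rot : {perm dart G}) : {perm dart G} :=
  (perm rev_dart_inj * rot)%g.
End Darts.

(* Connectedness is required because the faces of a disconnected plane graph
   are not the orbits of face_perm. *)
Record plane_graph := PlaneGraph {
  pgraph :> sgraph;
  rot : {perm dart pgraph};
  rotP : forall d : dart pgraph,
    porbit rot d = [set d' | tail d' == tail d];
  plane_connected : connected pgraph;
  plane_euler : #|pgraph| + #|porbits (face_perm rot)| = #|edges pgraph| + 2 }.

Definition faces (G : plane_graph) : {set {set dart G}} :=
  porbits (face_perm (rot G)).

(* The facial walk has length k and meets k distinct vertices (used only for
   k > 2). *)
Definition bounded_by_cycle (G : plane_graph) (k : nat) (F : {set dart G}) :=
  (#|F| == k) && (#|[set tail d | d in F]| == k).

Definition num_faces (G : plane_graph) (k : nat) : nat :=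
  #|[set F in faces G | bounded_by_cycle k F]|.

Definition is_46fullerene (G : plane_graph) : Prop :=
  [/\ cubic G,
      forall F, F \in faces G -> bounded_by_cycle 4 F || bounded_by_cycle 6 F
    & num_faces G 4 = 6].

(* Main.v *)
(** A k-matching is, up to [2^k k!] relabellings, a placement of the pattern [k K_2]
    (an injective map preserving adjacency), so everything reduces to counting
    placements of small patterns.  In a d-regular graph of order n the number P(H) of
    placements of H satisfies P(H + isolated vertex) = (n - |H|) P(H) and
    P(H + pendant vertex at i) = d P(H) - \sum_j P(H + edge ij), because the neighbours
    of the image of i that are already used are exactly the j giving a placement of
    H + ij.  These rules lower the number of vertices without raising the number of
    edges, so with at most six edges they end at the empty pattern, at the 4-cycle or
    at the 6-cycle, once patterns containing a vertex of degree 4, an odd cycle or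
    [K_{2,3}] are known not to occur.  The number of 6-cycles enters both M(G,6) and
    N(Q), and is eliminated between them.

    A (4,6)-fullerene is bipartite: by Euler's formula the ranks over [F_2] of the
    vertex-edge and face-edge incidence matrices add up to the number of edges, so a
    vector orthogonal to every face, such as the all-one vector when the faces are
    even, is a coboundary, i.e. a 2-colouring.

    Every 4-cycle bounds a face.  Encode a walk by its turns, L (left) or R (right); up
    to rotation and reversal a 4-cycle that is not facial reads LLLR, LLRR or LRLR.  In
    the first case a face would meet a vertex twice.  In the other two the faces along
    the cycle are hexagons, and crossing them leads to 4-cycles with the same turns: the
    hexagons form a tube which never ends, hence is the whole graph, and there would be
    no square.  So a 4-cycle is given by a dart of a square together with a side, and
    there are 48 labelled ones; opposite turns at a common vertex exclude [K_{2,3}]. *)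

Require Import Defs.
From Stdlib Require Import ZArith.
From mathcomp Require Import all_boot all_algebra all_fingroup.
From mathcomp Require Import ssrZ zify lra.
Import GRing.Theory Num.Theory.

Set Implicit Arguments.
Unset Strict Implicit.
Unset Printing Implicit Defensive.

(** * Edges, embeddings and subgraphs *)

Lemma eq_set2 (T : finType) (x y a b : T) :
  ([set x; y] == [set a; b]) = ((x, y) == (a, b)) || ((x, y) == (b, a)).
Proof.
apply/eqP/orP => [/setP E | [] /eqP[-> ->] //]; last by rewrite setUC.
move: (E x) (E y) (E a) (E b); rewrite !inE !eqxx !orbT ![a == _]eq_sym ![b == _]eq_sym.
by rewrite !xpair_eqE; do 4!case: (_ == _) => //=; by [left | right].
Qed.

Section Edges.
Variable G : sgraph.
Implicit Types (x y : G) (e : {set G}).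

Lemma adj_neq x y : adj x y -> x != y.
Proof. by apply: contraTneq => ->; rewrite adj_irrefl. Qed.

Lemma mem_edges x y : ([set x; y] \in edges G) = adj x y.
Proof.
apply/imsetP/idP => [[[a b]] | xy]; last by exists (x, y); rewrite ?inE.
rewrite inE /= => ab /eqP; rewrite eq_set2.
by case/orP=> /eqP[-> ->]; rewrite // adj_sym.
Qed.

Lemma edgeP e : reflect (exists x y, adj x y /\ e = [set x; y]) (e \in edges G).
Proof.
apply: (iffP imsetP) => [[[x y]] | [x [y [xy ->]]]]; last by exists (x, y); rewrite ?inE.
by rewrite inE /= => xy ->; exists x, y.
Qed.

Lemma sum_edges (F : {set G} -> nat) :
  \sum_(p : G * G | adj p.1 p.2) F [set p.1; p.2] = 2 * \sum_(e in edges G) F e.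
Proof.
rewrite (partition_big (fun p : G * G => [set p.1; p.2]) (mem (edges G))) /=;
  last by move=> [x y] /= xy; rewrite mem_edges.
rewrite big_distrr; apply: eq_bigr => _ /edgeP[x [y [xy ->]]].
rewrite (eq_bigl (mem [set (x, y); (y, x)])) => [|[a b]] /=; last first.
  by rewrite !inE eq_set2; apply: andb_idl => /orP[] /eqP[-> ->]; rewrite // adj_sym.
rewrite big_setU1 ?inE ?xpair_eqE ?(negPf (adj_neq xy)) //= big_set1 [X in _ + F X]setUC.
by rewrite mul2n addnn.
Qed.

End Edges.

Section Embeddings.
Implicit Types Q R G : sgraph.

Definition embeddings Q G : {set {ffun Q -> G}} :=
  [set f : {ffun Q -> G} |
    injectiveb f && [forall x, forall y, adj x y ==> adj (f x) (f y)]].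

Lemma embeddingsP Q G (f : {ffun Q -> G}) :
  reflect (injective f /\ forall x y, adj x y -> adj (f x) (f y))
          (f \in embeddings Q G).
Proof.
rewrite inE; apply: (iffP andP) => -[/injectiveP f_inj f_adj]; split=> //.
  by move=> x y; have /forallP/(_ y)/implyP := forallP f_adj x.
by apply/forallP => x; apply/forallP => y; apply/implyP/f_adj.
Qed.

Definition image_subgraph Q G (f : Q -> G) : {set G} * {set {set G}} :=
  (f @: [set: Q], [set f @: (a : {set Q}) | a in edges Q]).

Definition copies Q G : {set {set G} * {set {set G}}} :=
  [set S | is_subgraph S && isomorphic_to Q S].

Lemma imset_set2 (T U : finType) (f : T -> U) x y : f @: [set x; y] = [set f x; f y].
Proof. by rewrite imsetU1 imset_set1. Qed.

Lemma copiesP Q G (S : {set G} * {set {set G}}) :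
  reflect (exists2 f : {ffun Q -> G}, f \in embeddings Q G & image_subgraph f = S)
          (S \in copies Q G).
Proof.
rewrite inE; apply: (iffP andP) => [[] | [f /embeddingsP[f_inj f_adj] <-]].
  case/andP=> /subsetP S_sub _ /existsP[f /and3P[/injectiveP f_inj /eqP verts /eqP eds]].
  exists f; last by rewrite /image_subgraph -verts -eds -surjective_pairing.
  apply/embeddingsP; split=> // x y xy; rewrite -mem_edges -imset_set2.
  by apply: S_sub; rewrite eds; apply: imset_f; rewrite mem_edges.
split; last by apply/existsP; exists f; rewrite !eqxx !andbT; apply/injectiveP.
apply/andP; split; last by apply/forall_inP => _ /imsetP[a _ ->]; exact/imsetS/subsetT.
apply/subsetP => _ /imsetP[_ /edgeP[x [y [xy ->]]] ->].
by rewrite imset_set2 mem_edges f_adj.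
Qed.

Lemma image_subgraph_automorphism Q (s : {ffun Q -> Q}) :
  s \in embeddings Q Q -> image_subgraph s = image_subgraph (id : Q -> Q).
Proof.
case/embeddingsP=> s_inj s_adj; congr pair; apply/eqP; rewrite eqEcard.
  by rewrite imset_id subsetT (card_imset _ s_inj) leqnn.
have -> : [set id @: (a : {set Q}) | a in edges Q] = edges Q.
  by rewrite (eq_imset (g := id)) ?imset_id // => a; rewrite imset_id.
rewrite (card_imset _ (imset_inj s_inj)) leqnn andbT.
apply/subsetP => _ /imsetP[_ /edgeP[x [y [xy ->]]] ->].
by rewrite imset_set2 mem_edges s_adj.
Qed.

Lemma image_subgraph_comp Q R G (f : R -> G) (g : Q -> R) :
  image_subgraph (f \o g) =
  (f @: (image_subgraph g).1, [set f @: (a : {set R}) | a in (image_subgraph g).2]).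
Proof.
congr pair; first exact: imset_comp.
by rewrite -[RHS]imset_comp; apply: eq_imset => a; apply: imset_comp.
Qed.

Lemma embedding_factor Q G (f g : {ffun Q -> G}) :
  f \in embeddings Q G -> g \in embeddings Q G ->
  image_subgraph g = image_subgraph f ->
  exists2 s, s \in embeddings Q Q & g = [ffun x => f (s x)].
Proof.
move=> /embeddingsP[f_inj _] /embeddingsP[g_inj g_adj] [gT gE].
have f_onto x : exists y, f y == g x.
  have : g x \in f @: [set: Q] by rewrite -gT imset_f.
  by case/imsetP=> y _ ->; exists y.
pose s x := xchoose (f_onto x).
have fs x : f (s x) = g x by apply/eqP/(xchooseP (f_onto x)).
exists [ffun x => s x]; last by apply/ffunP => x; rewrite !ffunE fs.
apply/embeddingsP; split=> [x y | x y xy]; rewrite !ffunE.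
  by move/(congr1 f); rewrite !fs => /g_inj.
have : [set g x; g y] \in [set f @: (a : {set Q}) | a in edges Q].
  by rewrite -gE -imset_set2; apply: imset_f; rewrite mem_edges.
rewrite -!fs -imset_set2 => /imsetP[e eQ /(imset_inj f_inj) sE].
by rewrite -mem_edges sE.
Qed.

Lemma num_subgraphs_embeddings Q G :
  num_subgraphs Q G * #|embeddings Q Q| = #|embeddings Q G|.
Proof.
rewrite -[RHS]sum1_card.
rewrite (partition_big (fun f : {ffun Q -> G} => image_subgraph f) (mem (copies Q G)));
  last by move=> f fE; apply/copiesP; exists f.
rewrite -sum_nat_const; apply: eq_bigr => _ /copiesP[f fE <-].
pose precompose (s : {ffun Q -> Q}) := [ffun x => f (s x)].
have [f_inj f_adj] := embeddingsP _ fE.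
have precompose_inj : injective precompose.
  move=> s s' /ffunP E; apply/ffunP => x; apply: f_inj.
  by have := E x; rewrite !ffunE.
rewrite sum1_card -(card_imset _ precompose_inj); apply: eq_card => g.
rewrite -topredE /=; apply/imsetP/andP => [[s sE ->] | [gE /eqP gf]]; last first.
  by have [s sE ->] := embedding_factor fE gE gf; exists s.
have [s_inj s_adj] := embeddingsP _ sE; split.
  apply/embeddingsP; split=> [x y | x y xy]; rewrite !ffunE; first by move/f_inj/s_inj.
  exact/f_adj/s_adj.
apply/eqP; transitivity (image_subgraph (f \o s)).
  congr pair; first by apply: eq_imset => x; rewrite ffunE.
  by apply: eq_imset => a; apply: eq_imset => x; rewrite ffunE.
by rewrite image_subgraph_comp image_subgraph_automorphism // -image_subgraph_comp.
Qed.

End Embeddings.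

(** * Placements of patterns *)

(* A pattern of order m is a graph on the vertices 0, ..., m - 1, given by its
   list of edges. *)
Definition pattern := seq (nat * nat).

Definition shift_pattern (l : pattern) : pattern := [seq (e.1.+1, e.2.+1) | e <- l].

Definition C4_pattern : pattern := [:: (0, 1); (1, 2); (2, 3); (3, 0)].

Definition C6_pattern : pattern :=
  [:: (0, 1); (1, 2); (2, 3); (3, 4); (4, 5); (5, 0)].

Fixpoint matching_pattern (k : nat) : pattern :=
  if k is k'.+1 then (0, 1) :: shift_pattern (shift_pattern (matching_pattern k'))
  else [::].

Definition Q_pattern : pattern :=
  [:: (0, 1); (1, 2); (2, 3); (3, 4); (4, 5); (6, 7)].

Definition pattern_adj (l : pattern) (a b : nat) : bool :=
  ((a, b) \in l) || ((b, a) \in l).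

Definition pattern_nbrs (m : nat) (l : pattern) (a : nat) : seq nat :=
  [seq b <- iota 0 m | pattern_adj l a b].

Definition pattern_walk_ends (k m : nat) (l : pattern) (a : nat) : seq nat :=
  iter k (fun s => flatten (map (pattern_nbrs m l) s)) [:: a].

(* s is read as the map sending the vertex k of l to the vertex s_k of l'. *)
Definition pattern_map (m : nat) (l l' : pattern) (s : seq nat) : bool :=
  perm_eq s (iota 0 m)
  && all (fun e => [&& e.1 < m, e.2 < m & pattern_adj l' (nth 0 s e.1) (nth 0 s e.2)]) l.

Definition pattern_iso (m : nat) (l l' : pattern) (s : seq nat) : bool :=
  pattern_map m l l' s && pattern_map m l' l [seq index k s | k <- iota 0 m].

Lemma big_tuple_cons (T : finType) (m : nat) (F : m.+1.-tuple T -> nat) :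
  \sum_t F t = \sum_(t : m.-tuple T) \sum_(y : T) F (cons_tuple y t).
Proof.
rewrite exchange_big pair_bigA /=.
rewrite (reindex (fun p : T * m.-tuple T => cons_tuple p.1 p.2)) //=.
exists (fun t => (thead t, behead_tuple t)) => [[y t] _ | t _] /=.
  by congr pair; apply: val_inj.
by rewrite [RHS]tuple_eta; apply: val_inj.
Qed.

Section Placements.
Variables (G : sgraph) (x0 : G).
Implicit Types (l : pattern) (t : seq G).

Definition placement l t : bool :=
  uniq t && all (fun e => adj (nth x0 t e.1) (nth x0 t e.2)) l.

Definition num_placements (m : nat) l : nat := \sum_(t : m.-tuple G) placement l t.

Lemma placement_shift l y t :
  placement (shift_pattern l) (y :: t) = (y \notin t) && placement l t.
Proof. by rewrite /placement /= all_map -andbA. Qed.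

Lemma placement_cons e l t :
  placement (e :: l) t = adj (nth x0 t e.1) (nth x0 t e.2) && placement l t.
Proof. by rewrite /placement /= andbCA. Qed.

Lemma placement_adj l t a b :
  placement l t -> pattern_adj l a b -> adj (nth x0 t a) (nth x0 t b).
Proof. by case/andP=> _ /allP tl /orP[] /tl //=; rewrite adj_sym. Qed.

Lemma num_placements_nil : num_placements 0 [::] = 1.
Proof.
rewrite /num_placements (eq_bigr (fun=> 1)) => [|t _]; last by rewrite (tuple0 t).
by rewrite sum1_card card_tuple.
Qed.

Lemma num_placements_isolated (m : nat) l :
  num_placements m.+1 (shift_pattern l) + m * num_placements m l
  = #|G| * num_placements m l.
Proof.
rewrite /num_placements big_tuple_cons !big_distrr -big_split /=.
apply: eq_bigr => t _; under eq_bigr do rewrite placement_shift.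
case: (boolP (placement l t)) => [/andP[ut _] | _] /=; last first.
  by rewrite big1 ?muln0 // => y _; rewrite andbF.
under eq_bigr do rewrite andbT.
rewrite !muln1 -[in RHS](cardC (mem t)) (card_uniqP ut) size_tuple addnC; congr addn.
rewrite -sum1_card [RHS]big_mkcond; apply: eq_bigr => y _.
by rewrite !inE; case: (_ \in _).
Qed.

Lemma num_placements_pendant (d m i : nat) l : (forall x : G, #|neighbours x| = d) ->
  num_placements m.+1 ((0, i.+1) :: shift_pattern l)
    + \sum_(j < m) num_placements m ((i, nat_of_ord j) :: l)
  = d * num_placements m l.
Proof.
move=> regG; rewrite /num_placements big_tuple_cons [X in _ + X]exchange_big.
rewrite -big_split big_distrr /=; apply: eq_bigr => t _.
under eq_bigr do rewrite placement_cons placement_shift /=.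
under [X in _ + X]eq_bigr do rewrite placement_cons /=.
case: (boolP (placement l t)) => [/andP[ut _] | _] /=; last first.
  by rewrite !big1 ?muln0 // => y _; rewrite !andbF.
rewrite muln1; set x := nth x0 t i; rewrite -(regG x) -(cardID (mem t)) addnC.
congr addn; rewrite -sum1_card [RHS]big_mkcond /=.
  under eq_bigr do rewrite andbT -(tnth_nth x0).
  rewrite -(big_tuple _ _ t xpredT (fun y => adj x y : nat)) big_uniq //= big_mkcond.
  by apply: eq_bigr => y _; rewrite !inE; case: (y \in t); case: (adj x y).
apply: eq_bigr => y _; rewrite !inE andbT adj_sym andbC.
by case: (_ \in _); case: (adj x y).
Qed.

Lemma leq_num_placements (m : nat) l l' s :
  pattern_map m l l' s -> num_placements m l' <= num_placements m l.
Proof.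
case/andP=> s_perm /allP s_adj.
have size_s : size s = m by rewrite (perm_size s_perm) size_iota.
have mem_s k : (k \in s) = (k < m) by rewrite (perm_mem s_perm) mem_iota.
have size_st (t : m.-tuple G) : size [seq nth x0 t k | k <- s] == m.
  by rewrite size_map size_s.
pose relabel (t : m.-tuple G) : m.-tuple G := Tuple (size_st t).
have relabel_inj : injective relabel.
  move=> t t' /(congr1 val) /= /eq_in_map tt'; apply: val_inj.
  apply: (@eq_from_nth _ x0) => [|k]; rewrite !size_tuple // => km.
  by apply: tt'; rewrite mem_s.
rewrite /num_placements [X in _ <= X](reindex_inj relabel_inj).
apply: leq_sum => t _; case tl' : (placement l' t) => //; rewrite lt0b.
apply/andP; split; last first.
  apply/allP => e /s_adj/and3P[src_lt tgt_lt st_adj].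
  by rewrite !(nth_map 0) ?size_s // (placement_adj tl').
case/andP: tl' => ut _; rewrite map_inj_in_uniq ?(perm_uniq s_perm) ?iota_uniq //.
by move=> a b; rewrite !mem_s => am bm /eqP; rewrite nth_uniq ?size_tuple // => /eqP.
Qed.

Lemma num_placements_iso (m : nat) l l' s :
  pattern_iso m l l' s -> num_placements m l = num_placements m l'.
Proof.
case/andP=> ll' l'l; apply/eqP.
by rewrite eqn_leq (leq_num_placements ll') (leq_num_placements l'l).
Qed.

Lemma leq_size_placement (m : nat) l (t : m.-tuple G) (s : seq nat) (A : {set G}) :
  placement l t -> uniq s -> (forall b, b \in s -> b < m /\ nth x0 t b \in A) ->
  size s <= #|A|.
Proof.
case/andP=> ut _ us sA; rewrite -(size_map (nth x0 t)).
have /card_uniqP <- : uniq [seq nth x0 t b | b <- s].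
  rewrite map_inj_in_uniq // => a b /sA[am _] /sA[bm _] /eqP.
  by rewrite nth_uniq ?size_tuple // => /eqP.
by apply/subset_leq_card/subsetP => _ /mapP[b /sA[_ bA] ->].
Qed.

Lemma placement_degree (d m : nat) l (t : m.-tuple G) a :
  (forall x : G, #|neighbours x| = d) -> placement l t -> size (pattern_nbrs m l a) <= d.
Proof.
move=> regG tl; rewrite -(regG (nth x0 t a)).
apply: (leq_size_placement tl) => [|b]; first by rewrite filter_uniq ?iota_uniq.
by rewrite mem_filter mem_iota inE => /andP[/(placement_adj tl)].
Qed.

Lemma placement_common_nbrs (c m : nat) l (t : m.-tuple G) a b :
  (forall x y : G, x != y -> #|neighbours x :&: neighbours y| <= c) ->
  placement l t -> a < b < m ->
  count (pattern_adj l b) (pattern_nbrs m l a) <= c.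
Proof.
move=> common tl /andP[ab bm]; have /andP[ut _] := tl.
apply: leq_trans (common (nth x0 t a) (nth x0 t b) _); last first.
  by rewrite nth_uniq ?size_tuple ?(ltn_trans ab) // ltn_eqF.
rewrite -size_filter; apply: (leq_size_placement tl) => [|e].
  by rewrite !filter_uniq ?iota_uniq.
rewrite !mem_filter mem_iota !inE.
by case/and3P=> /(placement_adj tl)-> /(placement_adj tl)->.
Qed.

Definition proper_2colouring (u : G -> bool) := forall x y : G, adj x y -> u x != u y.

Lemma placement_walk_colour (u : G -> bool) (k m : nat) l (t : m.-tuple G) a b :
  proper_2colouring u -> placement l t -> b \in pattern_walk_ends k m l a ->
  u (nth x0 t b) = odd k (+) u (nth x0 t a).
Proof.
move=> colour tl; elim: k b => [|k IH] b /=; first by rewrite inE => /eqP ->.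
case/flattenP=> _ /mapP[c /IH uc ->]; rewrite mem_filter => /andP[].
move/(placement_adj tl)/colour; rewrite uc => + _.
by case: (odd k); case: (u _); case: (u _).
Qed.

End Placements.

Definition bipartite (G : sgraph) : Prop := exists u : G -> bool, proper_2colouring u.

Definition K23_free (G : sgraph) : Prop :=
  forall x y : G, x != y -> #|neighbours x :&: neighbours y| <= 2.

(* A closed walk of length 5 exists as soon as there is a loop, a triangle or a
   pentagon. *)
Definition forbidden_pattern (m : nat) (l : pattern) : bool :=
  let v := iota 0 m in
  [|| has (fun a => 3 < size (pattern_nbrs m l a)) v,
      has (fun a => a \in pattern_walk_ends 5 m l a) v
    | has (fun a => has (fun b =>
        (a < b) && (2 < count (pattern_adj l b) (pattern_nbrs m l a))) v) v].

Lemma num_placements_forbidden (G : sgraph) (x0 : G) (m : nat) l :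
  cubic G -> bipartite G -> K23_free G -> forbidden_pattern m l ->
  num_placements x0 m l = 0.
Proof.
move=> cubicG [u colour] K23G bad; apply: big1 => t _; apply/eqP; rewrite eqb0.
apply: contraL bad => tl; rewrite !negb_or; apply/and3P; split; apply/hasPn => a am.
- by rewrite -leqNgt; apply: placement_degree tl.
- by apply/negP => /(placement_walk_colour colour tl); case: (u _).
- apply/hasPn => b; rewrite mem_iota => bm; rewrite negb_and -implybE -leqNgt.
  by apply/implyP => ab; apply: (placement_common_nbrs K23G tl); rewrite ab.
Qed.

(** * Evaluation of patterns with at most six edges *)

Definition vertex_invariant (m : nat) (l : pattern) (a : nat) : nat * nat :=
  let s := pattern_nbrs m l a in
  (size s, sumn [seq size (pattern_nbrs m l b) | b <- s]).

(* Backtracking search; its result is certified by pattern_iso. *)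
Fixpoint find_iso (fuel m : nat) (l l' : pattern) (s : seq nat) : seq nat :=
  if fuel is fuel'.+1 then
    let k := size s in
    (fix first_success vs := if vs is v :: vs' then
       let r :=
         if v \in s then [::]
         else if vertex_invariant m l' v != vertex_invariant m l k then [::]
         else if all (fun j => pattern_adj l' v (nth 0 s j) == pattern_adj l k j)
                     (iota 0 k)
         then find_iso fuel' m l l' (rcons s v) else [::] in
       if r is [::] then first_success vs' else r
     else [::]) (iota 0 m)
  else s.

Section Polynomials.
Local Open Scope Z_scope.

Definition poly_eval (p : seq Z) (x : Z) : Z := foldr (fun c r => c + x * r) 0 p.

Fixpoint poly_sub (p q : seq Z) : seq Z :=
  match p, q with
  | a :: p', b :: q' => a - b :: poly_sub p' q'
  | [::], _ => map Z.opp q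
  | _, [::] => p
  end.

Definition poly_scale (a : Z) (p : seq Z) : seq Z := map (Z.mul a) p.

Lemma poly_eval_opp p x : poly_eval (map Z.opp p) x = - poly_eval p x.
Proof. by elim: p => [|c p IH]; rewrite /= ?IH; lia. Qed.

Lemma poly_eval_sub p q x : poly_eval (poly_sub p q) x = poly_eval p x - poly_eval q x.
Proof.
elim: p q => [|a p IH] [|b q]; rewrite /= ?IH ?poly_eval_opp; lia.
Qed.

Lemma poly_eval_scale a p x : poly_eval (poly_scale a p) x = a * poly_eval p x.
Proof. by elim: p => [|b p IH]; rewrite /= ?IH; lia. Qed.

(* (p, q, r) stands for p(n) + N4 q(n) + N6 r(n), where N4 and N6 are the numbers
   of placements of the 4-cycle and of the 6-cycle in a graph of order n. *)
Definition value := (seq Z * seq Z * seq Z)%type.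

Definition value_eval (n N4 N6 : Z) (v : value) : Z :=
  let: (p, q, r) := v in poly_eval p n + N4 * poly_eval q n + N6 * poly_eval r n.

Definition value_sub (v w : value) : value :=
  (poly_sub v.1.1 w.1.1, poly_sub v.1.2 w.1.2, poly_sub v.2 w.2).

Definition value_scale (a : Z) (v : value) : value :=
  (poly_scale a v.1.1, poly_scale a v.1.2, poly_scale a v.2).

Definition value_mulX (v : value) : value := (0 :: v.1.1, 0 :: v.1.2, 0 :: v.2).

Lemma value_eval_sub n N4 N6 v w :
  value_eval n N4 N6 (value_sub v w) = value_eval n N4 N6 v - value_eval n N4 N6 w.
Proof. by case: v w => [[p q] r] [[p' q'] r']; rewrite /= !poly_eval_sub; lia. Qed.

Lemma value_eval_scale n N4 N6 a v :
  value_eval n N4 N6 (value_scale a v) = a * value_eval n N4 N6 v.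
Proof. by case: v => [[p q] r]; rewrite /= !poly_eval_scale; lia. Qed.

Lemma value_eval_mulX n N4 N6 v :
  value_eval n N4 N6 (value_mulX v) = n * value_eval n N4 N6 v.
Proof. by case: v => [[p q] r] /=; lia. Qed.

End Polynomials.

Definition entry := (nat * pattern * value)%type.

Section Table.
Implicit Types (tbl : seq entry) (m : nat) (l : pattern) (v : value).

Fixpoint lookup tbl m l : option value :=
  if tbl is (m', l', v) :: tbl' then
    if m' != m then lookup tbl' m l
    else if pattern_iso m l l' (find_iso m m l l' [::]) then Some v
    else lookup tbl' m l
  else None.

Definition find_value tbl m l : option value :=
  if forbidden_pattern m l then Some ([::], [::], [::]) else lookup tbl m l.

Definition isolated_value m v : value :=
  value_sub (value_mulX v) (value_scale (Z.of_nat m) v).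

Definition pendant_value tbl m l (i : nat) v : option value :=
  foldr (fun j => obind (fun u => omap (value_sub u) (find_value tbl m ((i, j) :: l))))
    (Some (value_scale 3 v)) (iota 0 m).

Definition add_entry tbl (step : nat * option nat) : seq entry :=
  if onth tbl step.1 is Some (m, l, v) then
    if step.2 is Some i then
      if pendant_value tbl m l i v is Some w
      then rcons tbl (m.+1, (0, i.+1) :: shift_pattern l, w) else tbl
    else rcons tbl (m.+1, shift_pattern l, isolated_value m v)
  else tbl.

Definition base_entries : seq entry :=
  [:: (0, [::], ([:: Zpos 1], [::], [::]));
      (4, C4_pattern, ([::], [:: Zpos 1], [::]));
      (6, C6_pattern, ([::], [::], [:: Zpos 1]))].

(* (k, None) adds an isolated vertex to the k-th pattern of the table and
   (k, Some i) a pendant vertex at its vertex i; the new vertex is numbered 0.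
   Every pattern met by [add_entry] is forbidden or isomorphic to an earlier one. *)
Definition table_steps : seq (nat * option nat) :=
  [:: (0, None); (3, Some 0); (4, None); (4, Some 0); (5, Some 0); (7, None);
      (6, Some 0); (7, Some 0); (8, Some 0); (11, None); (9, Some 0);
      (10, Some 0); (11, Some 0); (12, Some 0); (16, None); (1, None);
      (1, Some 0); (18, Some 0); (13, Some 0); (14, Some 0); (15, Some 0);
      (16, Some 0); (17, Some 0); (25, None); (20, None); (19, Some 0);
      (20, Some 0); (20, Some 2); (27, Some 0); (21, Some 5); (22, Some 0);
      (23, Some 0); (24, Some 0); (25, Some 0); (26, Some 0)].

Definition pattern_table : seq entry := foldl add_entry base_entries table_steps.

End Table.

#[local] Arguments Z.add : simpl never.
#[local] Arguments Z.mul : simpl never.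
#[local] Arguments Z.pow : simpl never.

Section Soundness.
Variables (G : sgraph) (x0 : G).
Implicit Types (tbl : seq entry) (m : nat) (l : pattern) (v : value).
Hypotheses (cubicG : cubic G) (bipartiteG : bipartite G) (K23G : K23_free G).

Local Notation eval := (value_eval (Z.of_nat #|G|)
  (Z.of_nat (num_placements x0 4 C4_pattern))
  (Z.of_nat (num_placements x0 6 C6_pattern))).

Definition valid_entry (e : entry) : Prop :=
  Z.of_nat (num_placements x0 e.1.1 e.1.2) = eval e.2.

Definition valid_table tbl : Prop := forall e, e \in tbl -> valid_entry e.

Lemma valid_table_rcons tbl e :
  valid_table tbl -> valid_entry e -> valid_table (rcons tbl e).
Proof. by move=> tblV eV e'; rewrite mem_rcons inE => /predU1P[-> | /tblV]. Qed.

Lemma find_value_valid tbl m l v :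
  valid_table tbl -> find_value tbl m l = Some v -> valid_entry (m, l, v).
Proof.
rewrite /find_value; case: ifP => [bad _ [<-] | _].
  by rewrite /valid_entry (num_placements_forbidden x0 cubicG _ K23G bad) //=; lia.
elim: tbl => //= -[[m' l'] w] tbl IH tblV.
have {}IH : lookup tbl m l = Some v -> valid_entry (m, l, v).
  by apply: IH => e etbl; apply: tblV; rewrite inE etbl orbT.
case: eqP tblV => //= -> tblV; case: ifP => // /(num_placements_iso x0) ll' [<-].
by rewrite /valid_entry ll'; apply: (tblV (m, l', w)); rewrite inE eqxx.
Qed.

Lemma isolated_value_valid m l v :
  valid_entry (m, l, v) -> valid_entry (m.+1, shift_pattern l, isolated_value m v).
Proof.
rewrite /valid_entry value_eval_sub value_eval_mulX value_eval_scale /= => <-.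
have := num_placements_isolated x0 m l.
by move: #|G| (num_placements x0 m.+1 _) (num_placements x0 m l) => n a b; lia.
Qed.

Lemma pendant_value_valid tbl m l i v w : valid_table tbl -> valid_entry (m, l, v) ->
  pendant_value tbl m l i v = Some w ->
  valid_entry (m.+1, (0, i.+1) :: shift_pattern l, w).
Proof.
move=> tblV lV wE; have := num_placements_pendant x0 m i l cubicG.
rewrite -(big_mkord xpredT (fun j => num_placements x0 m ((i, j) :: l))).
rewrite /index_iota subn0; rewrite /valid_entry /= in lV *.
suff -> : eval w = Z.sub (Z.of_nat (3 * num_placements x0 m l))
    (Z.of_nat (\sum_(j <- iota 0 m) num_placements x0 m ((i, j) :: l))) by lia.
move: wE; rewrite /pendant_value; elim: (iota 0 m) w => [|j s IH] w /=.
  by case=> <-; rewrite big_nil value_eval_scale -lV; lia.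
case: foldr IH => //= u /(_ u erefl) IH.
case E : find_value => [z|] //= [<-].
by rewrite big_cons value_eval_sub IH -(find_value_valid tblV E) /=; lia.
Qed.

Lemma add_entry_valid tbl step : valid_table tbl -> valid_table (add_entry tbl step).
Proof.
case: step => k o tblV; rewrite /add_entry /=.
case E : (onth tbl k) => [[[m l] v]|] //.
have lV : valid_entry (m, l, v) by apply: tblV; apply/onthP; exists k.
case: o => [i|]; last exact/valid_table_rcons/isolated_value_valid.
case wE : pendant_value => [w|] //; apply: valid_table_rcons => //.
exact: pendant_value_valid wE.
Qed.

Lemma table_valid : valid_table pattern_table.
Proof.
have: valid_table base_entries.
  move=> e; rewrite !inE => /or3P[] /eqP->; rewrite /valid_entry /=; [|lia..].
  by rewrite num_placements_nil; lia.
rewrite /pattern_table; elim: table_steps base_entries => //= k s IH tbl tblV.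
exact/IH/add_entry_valid.
Qed.

Lemma placements_from_table m l v :
  find_value pattern_table m l = Some v -> Z.of_nat (num_placements x0 m l) = eval v.
Proof. exact: (find_value_valid table_valid). Qed.

End Soundness.

Section TableValues.
Local Open Scope Z_scope.

Lemma table_values :
  [:: find_value pattern_table 8 (matching_pattern 4);
      find_value pattern_table 10 (matching_pattern 5);
      find_value pattern_table 12 (matching_pattern 6);
      find_value pattern_table 8 Q_pattern]
  = [seq Some v | v <-
      [:: ([:: 0; -26064; 11052; -1620; 81], [:: 48; 0; 0; 0], [:: 0; 0; 0; 0]);
          ([:: 0; 1360512; -599760; 103140; -8100; 243],
           [:: -7680; 720; 0; 0; 0], [:: 0; 0; 0; 0; 0]);
          ([:: 0; -91480320; 41062176; -7682040; 740340; -36450; 729],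
           [:: 1013760; -159840; 6480; 0; 0; 0], [:: 3840; 0; 0; 0; 0; 0]);
          ([:: 0; -1248; 144], [:: 88; -9], [:: 2; 0])]].
Proof. by vm_compute. Qed.

Lemma num_placements_cubic_bipartite (G : sgraph) (x0 : G) :
  cubic G -> bipartite G -> K23_free G ->
  let n := Z.of_nat #|G| in
  let N4 := Z.of_nat (num_placements x0 4 C4_pattern) in
  let N6 := Z.of_nat (num_placements x0 6 C6_pattern) in
  [/\ Z.of_nat (num_placements x0 8 (matching_pattern 4)) =
        81 * n ^ 4 - 1620 * n ^ 3 + 11052 * n ^ 2 - 26064 * n + 48 * N4,
      Z.of_nat (num_placements x0 10 (matching_pattern 5)) =
        243 * n ^ 5 - 8100 * n ^ 4 + 103140 * n ^ 3 - 599760 * n ^ 2 + 1360512 * n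
        + (720 * n - 7680) * N4,
      Z.of_nat (num_placements x0 12 (matching_pattern 6)) =
        729 * n ^ 6 - 36450 * n ^ 5 + 740340 * n ^ 4 - 7682040 * n ^ 3
        + 41062176 * n ^ 2 - 91480320 * n
        + (6480 * n ^ 2 - 159840 * n + 1013760) * N4 + 3840 * N6
    & Z.of_nat (num_placements x0 8 Q_pattern) =
        144 * n ^ 2 - 1248 * n + (88 - 9 * n) * N4 + 2 * N6].
Proof.
move=> cubicG bipartiteG K23G n N4 N6.
have := placements_from_table x0 cubicG bipartiteG K23G.
move: (find_value pattern_table) table_values => value_at [M4E M5E M6E QE] value_of.
split; [rewrite (value_of _ _ _ M4E) | rewrite (value_of _ _ _ M5E)
  | rewrite (value_of _ _ _ M6E) | rewrite (value_of _ _ _ QE)];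
  by rewrite /= -/n -/N4 -/N6; ring.
Qed.

End TableValues.

(** * Matchings as placements *)

Lemma trivIset_setU1 (T : finType) (A : {set T}) (P : {set {set T}}) : A \notin P ->
  trivIset (A |: P) = trivIset P && [disjoint A & cover P].
Proof.
move=> AP; apply/idP/andP => [tAP | [/trivIsetP tP /bigcup_disjointP dAP]].
  split; first exact: trivIsetS (subsetUr _ _) tAP.
  apply/bigcup_disjointP => B BP; rewrite disjoint_sym.
  apply: (trivIsetP tAP); rewrite ?setU11 ?inE ?BP ?orbT //.
  by apply: contraNneq AP => <-.
apply/trivIsetP => B C; rewrite !inE => /predU1P[-> | BP] /predU1P[-> | CP].
- by rewrite eqxx.
- by rewrite dAP.
- by rewrite disjoint_sym dAP.
- exact: tP.
Qed.

Section Matchings.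
Variables (G : sgraph) (x0 : G).

Lemma matchings0 : matchings G 0 = [set set0].
Proof.
apply/setP => S; rewrite !inE cards_eq0; case: eqP => [-> | _]; rewrite ?andbF //.
by rewrite sub0set andbT; apply/trivIsetP => A B; rewrite inE.
Qed.

Lemma matchingsU1 (k : nat) (S : {set {set G}}) e : e \notin S ->
  (e |: S \in matchings G k.+1)
  = [&& S \in matchings G k, e \in edges G & [disjoint e & cover S]].
Proof.
move=> eS; rewrite !inE subUset sub1set (trivIset_setU1 eS) cardsU1 eS eqSS.
by case: (e \in _); case: (S \subset _); case: trivIset; case: (#|S| == k);
  rewrite ?andbT ?andbF.
Qed.

Lemma notin_disjoint_cover (S : {set {set G}}) e :
  e \in edges G -> [disjoint e & cover S] -> e \notin S.
Proof.
case/edgeP=> x [y [_ ->]] dS; apply: contraL dS => eS.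
rewrite disjoints_subset; apply/subsetPn; exists x; first exact: set21.
by rewrite inE negbK; apply/bigcupP; exists [set x; y]; rewrite ?set21.
Qed.

(* Both sides sum over the matchings of size k + 1 with a marked edge. *)
Lemma sum_matchings_add_edge (k : nat) (F : {set {set G}} -> nat) :
  \sum_(S in matchings G k) \sum_(e in edges G | [disjoint e & cover S]) F (e |: S)
  = k.+1 * \sum_(S in matchings G k.+1) F S.
Proof.
transitivity (\sum_(S in matchings G k.+1) \sum_(e in S) F S); last first.
  rewrite big_distrr; apply: eq_bigr => S; rewrite inE => /and3P[_ _ /eqP Sk].
  by rewrite sum_nat_const Sk.
rewrite !pair_big_dep [RHS](reindex_onto (fun p => (p.2 |: p.1, p.2))
  (fun p => (p.1 :\ p.2, p.2))) /=; last by move=> [S e] /= /andP[_ eS]; rewrite setD1K.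
apply: eq_bigl => [[S e]] /=; rewrite setU11 andbT xpair_eqE eqxx andbT.
have [eS | eS] := boolP (e \in S).
  rewrite setUC (_ : (_ :|: _) :\ e == S = false) ?andbF; last first.
    by apply/eqP => E; move: eS; rewrite -E !inE eqxx.
  by apply/and3P => -[_ /notin_disjoint_cover eNS /eNS]; rewrite eS.
by rewrite matchingsU1 // setU1K // eqxx andbT.
Qed.

Fixpoint consecutive_pairs (t : seq G) : {set {set G}} :=
  if t is x :: y :: t' then [set x; y] |: consecutive_pairs t' else set0.

Lemma cover_consecutive_pairs k (t : k.*2.-tuple G) : cover (consecutive_pairs t) =i t.
Proof.
elim: k t => [|k IH] t x; first by rewrite (tuple0 t) /cover big_set0 inE.
case/tupleP: t => y t; case/tupleP: t => z t /=.
by rewrite /cover bigcup_setU big_set1 inE -/(cover _) IH !inE orbA.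
Qed.

Lemma sum_placements_matching (k : nat) (F : {set {set G}} -> nat) :
  \sum_(t : k.*2.-tuple G) placement x0 (matching_pattern k) t * F (consecutive_pairs t)
  = 2 ^ k * k`! * \sum_(S in matchings G k) F S.
Proof.
elim: k F => [|k IH] F.
  rewrite [LHS](eq_bigr (fun=> F set0)) => [|t _]; last by rewrite (tuple0 t) mul1n.
  by rewrite sum_nat_const card_tuple matchings0 big_set1.
have -> : 2 ^ k.+1 * (k.+1)`! * \sum_(S in matchings G k.+1) F S
    = 2 ^ k * k`! * (2 * (k.+1 * \sum_(S in matchings G k.+1) F S)).
  by rewrite expnS factS; lia.
rewrite -sum_matchings_add_edge big_distrr -IH !big_tuple_cons /=.
apply: eq_bigr => t _; set S := consecutive_pairs t.
transitivity (\sum_(p : G * G | adj p.1 p.2) placement x0 (matching_pattern k) t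
    * ([disjoint [set p.1; p.2] & cover S] * F ([set p.1; p.2] |: S))).
  rewrite exchange_big pair_big [RHS]big_mkcond; apply: eq_bigr => [[x y] _] /=.
  rewrite placement_cons !placement_shift /= inE negb_or.
  case: ifP => //= xy; rewrite (adj_neq xy) /= mulnA mulnb; congr (nat_of_bool _ * _).
  rewrite andbA andbC disjoints_subset subUset !sub1set !inE.
  by rewrite !cover_consecutive_pairs.
rewrite -big_distrr (sum_edges (fun e => [disjoint e & _] * F (e |: _))) big_mkcondr.
by congr (_ * (_ * _)); apply: eq_bigr => e _; case: ifP; rewrite ?mul1n.
Qed.

Lemma num_placements_matching (k : nat) :
  num_placements x0 k.*2 (matching_pattern k) = 2 ^ k * k`! * num_matchings G k.
Proof.
rewrite /num_matchings -sum1_card -(sum_placements_matching k (fun=> 1)).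
by apply: eq_bigr => t _; rewrite muln1.
Qed.

End Matchings.

(** * Copies of Q as placements *)

Definition Q_vertex (v : graphQ) : nat :=
  match v with inl i => i | inr j => 6 + j end.

Definition Q_index (i : 'I_8) : graphQ := @split 6 2 i.

Lemma Q_indexK (i : 'I_8) : Q_vertex (Q_index i) = i.
Proof. by rewrite -[in RHS](@splitK 6 2 i) /Q_index; case: split. Qed.

Lemma Q_vertex_lt (v : graphQ) : Q_vertex v < 8.
Proof. by case: v => [[i i6]|[j j2]] /=; lia. Qed.

Lemma Q_vertexK (v : graphQ) : Q_index (Ordinal (Q_vertex_lt v)) = v.
Proof. by rewrite -[RHS](@unsplitK 6 2); congr split; apply: val_inj; case: v. Qed.

Lemma Q_vertex_inj : injective Q_vertex.
Proof.
by move=> v w E; rewrite -[v]Q_vertexK -[w]Q_vertexK; congr Q_index; apply: val_inj.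
Qed.

Lemma Q_vertex_adj (v w : graphQ) :
  adj v w = pattern_adj Q_pattern (Q_vertex v) (Q_vertex w).
Proof.
case: v => [[v hv]|[v hv]]; case: w => [[w hw]|[w hw]] /=;
  do 6? [case: v hv => [|v] hv //]; do 6? [case: w hw => [|w] hw //].
Qed.

Lemma Q_pattern_lt a b : (a, b) \in Q_pattern -> (a < 8) && (b < 8).
Proof. by rewrite !inE; do 5?case/orP; move=> /eqP[-> ->]. Qed.

Section CopiesOfQ.
Variables (G : sgraph) (x0 : G).

Definition tuple_of_Q (f : {ffun graphQ -> G}) : 8.-tuple G :=
  [tuple f (Q_index i) | i < 8].

Lemma tuple_of_Q_bij : bijective tuple_of_Q.
Proof.
exists (fun t => [ffun v => tnth t (Ordinal (Q_vertex_lt v))]) => [f|t].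
  by apply/ffunP => v; rewrite ffunE tnth_mktuple Q_vertexK.
apply: eq_from_tnth => i; rewrite tnth_mktuple ffunE; congr tnth.
by apply: val_inj; rewrite /= Q_indexK.
Qed.

Lemma nth_tuple_of_Q f v : nth x0 (tuple_of_Q f) (Q_vertex v) = f v.
Proof.
by rewrite -[Q_vertex v]/(val (Ordinal (Q_vertex_lt v))) -tnth_nth tnth_mktuple
  Q_vertexK.
Qed.

Lemma placement_tuple_of_Q f :
  placement x0 Q_pattern (tuple_of_Q f) = (f \in embeddings graphQ G).
Proof.
apply/idP/(@embeddingsP graphQ G) => [fP | [f_inj f_adj]].
  split=> [v w|v w vw]; rewrite -!nth_tuple_of_Q; last first.
    by apply: placement_adj fP _; rewrite -Q_vertex_adj.
  have /andP[uf _] := fP; move/eqP; rewrite nth_uniq ?size_tuple ?Q_vertex_lt //.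
  by move/eqP/Q_vertex_inj.
apply/andP; split.
  apply/(tuple_uniqP (tuple_of_Q f)) => i j; rewrite !tnth_mktuple => /f_inj.
  by move/(congr1 Q_vertex); rewrite !Q_indexK => /val_inj.
apply/allP => -[a b] abQ /=; have /andP[a8 b8] := Q_pattern_lt abQ.
have := f_adj (Q_index (Ordinal a8)) (Q_index (Ordinal b8)).
by rewrite Q_vertex_adj -!nth_tuple_of_Q !Q_indexK /pattern_adj /= abQ; apply.
Qed.

Lemma card_embeddings_Q : #|embeddings graphQ G| = num_placements x0 8 Q_pattern.
Proof.
rewrite -sum1_card big_mkcond /num_placements (reindex tuple_of_Q) /=; last first.
  exact/onW_bij/tuple_of_Q_bij.
by apply: eq_bigr => f _; rewrite placement_tuple_of_Q; case: (_ \in _).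
Qed.

End CopiesOfQ.

Lemma perm_eq_iota (n : nat) (s : seq nat) : size s = n -> all (fun k => k < n) s ->
  perm_eq s (iota 0 n) = uniq s.
Proof.
move=> sn /allP s_lt; apply/idP/idP => [/perm_uniq -> | us]; first exact: iota_uniq.
apply: uniq_perm (iota_uniq 0 n) _ => //.
have s_sub : {subset s <= iota 0 n} by move=> k /s_lt; rewrite mem_iota.
by have [] := uniq_min_size us s_sub; rewrite ?size_iota ?sn.
Qed.

Lemma sum_tuple_relabel (T : finType) (n : nat) (f : T -> nat) (g : nat -> T)
    (P : pred (seq nat)) :
  injective f -> (forall k, k < n -> f (g k) = k) ->
  \sum_(t : n.-tuple T) perm_eq (map f t) (iota 0 n) && P (map f t)
  = count P (permutations (iota 0 n)).
Proof.
move=> f_inj fgK; rewrite -big_mkcond sum1_card cardE -size_filter.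
rewrite -(size_map (fun t : n.-tuple T => map f t)); apply/perm_size/uniq_perm.
- by rewrite map_inj_uniq ?enum_uniq // => t t' /(inj_map f_inj); apply: val_inj.
- by rewrite filter_uniq ?permutations_uniq.
move=> s; rewrite mem_filter mem_permutations andbC.
apply/mapP/andP => [[t] | [s_perm sP]].
  by rewrite mem_enum => /andP[t_perm tP] ->.
have size_gs : size (map g s) == n by rewrite size_map (perm_size s_perm) size_iota.
have fgs : map f (Tuple size_gs) = s.
  rewrite /= -map_comp -[RHS]map_id; apply/eq_in_map => k.
  by rewrite (perm_mem s_perm) mem_iota => /fgK.
by exists (Tuple size_gs); rewrite ?fgs // mem_enum -topredE /= fgs s_perm.
Qed.

Definition preserves_Q_pattern (s : seq nat) : bool :=
  all (fun e => pattern_adj Q_pattern (nth 0 s e.1) (nth 0 s e.2)) Q_pattern.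

Lemma placement_Q_relabel (x0 : graphQ) (t : 8.-tuple graphQ) :
  placement x0 Q_pattern t
  = perm_eq (map Q_vertex t) (iota 0 8) && preserves_Q_pattern (map Q_vertex t).
Proof.
rewrite perm_eq_iota ?size_map ?size_tuple //; last first.
  by apply/allP => _ /mapP[v _ ->]; apply: Q_vertex_lt.
rewrite (map_inj_uniq Q_vertex_inj); congr andb.
apply: eq_in_all => -[a b] /Q_pattern_lt/andP[a8 b8].
by rewrite !(nth_map x0) ?size_tuple //= -Q_vertex_adj.
Qed.

Lemma count_preserves_Q_pattern :
  count preserves_Q_pattern (permutations (iota 0 8)) = 4.
Proof. by vm_compute. Qed.

Lemma card_automorphisms_Q : #|embeddings graphQ graphQ| = 4.
Proof.
rewrite (card_embeddings_Q (Q_index ord0)) /num_placements.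
under eq_bigr do rewrite placement_Q_relabel.
apply: etrans count_preserves_Q_pattern.
apply: (sum_tuple_relabel (g := Q_index \o inord) _ Q_vertex_inj) => k k8.
by rewrite /= Q_indexK inordK.
Qed.

Lemma num_placements_Q (G : sgraph) (x0 : G) :
  num_placements x0 8 Q_pattern = 4 * num_subgraphs graphQ G.
Proof.
by rewrite -card_embeddings_Q -num_subgraphs_embeddings card_automorphisms_Q mulnC.
Qed.

(** * Darts of a plane graph *)

Section DartBasics.
Variable G : sgraph.
Implicit Types (d : dart G) (x y : G).

Definition dart_head d : G := (val d).2.

Definition dart_edge d : {set G} := [set tail d; dart_head d].

Definition mk_dart x y (xy : adj x y) : dart G :=
  exist (fun d : G * G => adj d.1 d.2) (x, y) xy.

Lemma adj_dart d : adj (tail d) (dart_head d).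
Proof. exact: (valP d). Qed.

Lemma tail_rev_dart d : tail (rev_dart d) = dart_head d.
Proof. by []. Qed.

Lemma dart_head_rev d : dart_head (rev_dart d) = tail d.
Proof. by []. Qed.

Lemma dart_eq d d' : tail d = tail d' -> dart_head d = dart_head d' -> d = d'.
Proof.
by case: d d' => [[x y] p] [[x' y'] p'] /= tt' hh'; apply: val_inj; congr pair.
Qed.

Lemma rev_dartK : involutive (@rev_dart G).
Proof. by move=> d; apply: dart_eq. Qed.

Lemma rev_dart_neq d : rev_dart d != d.
Proof. by apply: contraTneq (adj_dart d) => {1}<-; rewrite tail_rev_dart adj_irrefl. Qed.

Lemma dart_edge_edges d : dart_edge d \in edges G.
Proof. by rewrite mem_edges adj_dart. Qed.

Lemma eq_dart_edge d d' : (dart_edge d' == dart_edge d) = (d' == d) || (d' == rev_dart d).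
Proof.
rewrite eq_set2; apply/orP/orP => -[] /eqP => [[t h] | [t h] | -> | ->]; rewrite ?eqxx;
  by [left; apply/eqP/dart_eq | right; apply/eqP/dart_eq | left | right].
Qed.

Lemma card_darts_at x : #|[set d | tail d == x]| = #|neighbours x|.
Proof.
rewrite -(@card_in_imset _ _ dart_head) => [|d d']; last first.
  by rewrite !inE => /eqP dx /eqP d'x; apply: dart_eq; rewrite dx d'x.
apply: eq_card => y; rewrite inE; apply/imsetP/idP => [[d] | xy].
  by rewrite inE => /eqP <- ->; apply: adj_dart.
by exists (mk_dart xy); rewrite ?inE.
Qed.

Lemma card_darts k : (forall x, #|neighbours x| = k) -> #|{: dart G}| = #|G| * k.
Proof.
move=> regG; rewrite -sum1_card (partition_big (@tail G) xpredT) //=.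
rewrite -sum_nat_const; apply: eq_bigr => x _.
by rewrite sum1_card -(regG x) -card_darts_at; apply: eq_card => d; rewrite !inE.
Qed.

End DartBasics.

Lemma connected_ind (G : sgraph) (P : G -> Prop) (x : G) : connected G ->
  P x -> (forall y z, adj y z -> P y -> P z) -> forall y, P y.
Proof.
move=> connG Px Padj y; have /connectP[p xp ->] := connG x y.
by elim: p x Px xp => //= z p IH x Px /andP[/Padj/(_ Px) Pz /(IH _ Pz)].
Qed.

Section PlaneDarts.
Variable G : plane_graph.
Local Notation rotation := (Defs.rot G).
Local Notation phi := (face_perm rotation).
Local Notation face := (porbit phi).
Implicit Types (d : dart G).

Lemma face_permE d : phi d = rotation (rev_dart d).
Proof. by rewrite permM permE. Qed.

Lemma tail_rotation d : tail (rotation d) = tail d.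
Proof.
have : rotation d \in porbit rotation d by rewrite -{1}[rotation]expg1 mem_porbit.
by rewrite rotP inE => /eqP.
Qed.

Lemma tail_face_perm d : tail (phi d) = dart_head d.
Proof. by rewrite face_permE tail_rotation tail_rev_dart. Qed.

Lemma face_next d : face (phi d) = face d.
Proof. by rewrite -(porbit_perm phi 1 d) expg1. Qed.

Lemma face_in_faces d : face d \in faces G.
Proof. exact: imset_f. Qed.

Lemma dart_ind (P : dart G -> Prop) (d0 : dart G) : P d0 ->
  (forall d, P d -> P (rev_dart d)) -> (forall d, P d -> P (rotation d)) -> forall d, P d.
Proof.
move=> Pd0 Prev Prot.
have Ptail d d' : tail d' = tail d -> P d -> P d'.
  move=> dd' Pd; have : d' \in porbit rotation d by rewrite rotP inE dd'.
  case/porbitP=> k ->; elim: k => [|k IH]; first by rewrite expg0 perm1.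
  by rewrite expgSr permM; apply: Prot.
suff Pat x : forall d, tail d = x -> P d by move=> d; apply: (Pat (tail d)).
move: x; apply: (connected_ind (x := tail d0) (@plane_connected G)) => [d dd0|].
  exact: Ptail Pd0.
move=> y z yz Py d dz; apply: (Ptail (rev_dart (mk_dart yz))); first by rewrite dz.
by apply/Prev/Py.
Qed.

End PlaneDarts.

(** * Plane graphs with even faces are bipartite *)

Section RowSpaces.
Local Open Scope ring_scope.
Variable F : fieldType.

Lemma sub_rowspace_of_orthogonal (p q e : nat)
    (A : 'M[F]_(p, e)) (B : 'M[F]_(q, e)) (u : 'rV[F]_e) :
  B *m A^T = 0 -> (e <= \rank A + \rank B)%N -> B *m u^T = 0 -> (u <= A)%MS.
Proof.
move=> BA0 rk Bu0; have kerB (n : nat) (M : 'M[F]_(n, e)) :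
    B *m M^T = 0 -> (M <= kermx B^T)%MS.
  by move=> BM0; apply/sub_kermxP; rewrite -[LHS]trmxK trmx_mul trmxK BM0 trmx0.
have /andP[_ kA] : (A == kermx B^T)%MS.
  by rewrite -(geq_leqif (mxrank_leqif_eq (kerB _ _ BA0))) mxrank_ker mxrank_tr
    leq_subLR addnC.
exact: submx_trans (kerB _ _ Bu0) kA.
Qed.

Lemma leq_rank_constant_ker (p q : nat) (M : 'M[F]_(p, q)) :
  (forall u : 'rV[F]_p, u *m M = 0 -> forall i j, u 0 i = u 0 j) ->
  (p <= (\rank M).+1)%N.
Proof.
move=> kerM; suff : (kermx M <= (const_mx 1 : 'rV_p))%MS.
  by move/mxrankS/leq_trans/(_ (rank_leq_row _)); rewrite mxrank_ker leq_subLR addn1.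
apply/row_subP => i; apply/submxP.
exists (row i (kermx M) 0 i)%:M; apply/rowP => j.
rewrite mul_scalar_mx !mxE mulr1.
have := kerM (row i (kermx M)); rewrite -row_mul mulmx_ker row0.
by move/(_ erefl j i); rewrite !mxE.
Qed.

End RowSpaces.

Section FieldOfTwoElements.
Local Open Scope ring_scope.

Lemma F2_add_neq0 (a b : 'F_2) : (a + b != 0) = (a != 0) (+) (b != 0).
Proof. by case: a => -[|[|?]] // ?; case: b => -[|[|?]] // ?. Qed.

Lemma F2_add_eq0 (a b : 'F_2) : a + b = 0 -> a = b.
Proof.
by case: a => -[|[|?]] // ?; case: b => -[|[|?]] // ? /eqP // _; apply: val_inj.
Qed.

Lemma F2_natr_eq0 (n : nat) : (n%:R == 0 :> 'F_2) = ~~ odd n.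
Proof. by rewrite -(dvdn_pcharf (pchar_Fp (isT : prime 2))) dvdn2. Qed.

End FieldOfTwoElements.

Section Homology.
Variables (G : plane_graph) (d0 : dart G).
Local Notation rotation := (Defs.rot G).
Local Notation phi := (face_perm rotation).
Local Notation face := (porbit phi).
Local Open Scope ring_scope.
Implicit Types (d : dart G).

Definition edge_rank d : 'I_#|edges G| :=
  enum_rank_in (dart_edge_edges d) (dart_edge d).

Definition face_rank d : 'I_#|faces G| := enum_rank_in (face_in_faces d) (face d).

Definition tail_rank d : 'I_#|G| := enum_rank (tail d).

Lemma eq_edge_rank d d' : (edge_rank d' == edge_rank d) = (d' == d) || (d' == rev_dart d).
Proof.
by rewrite -eq_dart_edge -(inj_eq enum_val_inj) !enum_rankK_in ?dart_edge_edges.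
Qed.

Lemma eq_face_rank d d' : (face_rank d' == face_rank d) = (face d' == face d).
Proof. by rewrite -(inj_eq enum_val_inj) !enum_rankK_in ?face_in_faces. Qed.

Lemma edge_rank_rev d : edge_rank (rev_dart d) = edge_rank d.
Proof. by apply/eqP; rewrite eq_edge_rank eqxx orbT. Qed.

Lemma edge_rank_onto e : exists d, edge_rank d == e.
Proof.
have /edgeP[x [y [xy xyE]]] := enum_valP e; exists (mk_dart xy).
by rewrite -(inj_eq enum_val_inj) enum_rankK_in ?dart_edge_edges ?xyE.
Qed.

Lemma face_rank_onto f : exists d, face_rank d = f.
Proof.
have /imsetP[d _ dE] := enum_valP f; exists d; apply: enum_val_inj.
by rewrite enum_rankK_in ?face_in_faces.
Qed.

Lemma tail_rank_onto v : exists d, tail_rank d = v.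
Proof.
suff [d dv] : exists d, tail d = enum_val v by exists d; rewrite /tail_rank dv enum_valK.
move: (enum_val v); apply: (connected_ind (x := tail d0) (@plane_connected G)).
  by exists d0.
by move=> y z; rewrite adj_sym => zy _; exists (mk_dart zy).
Qed.

Definition edge_dart e : dart G := xchoose (edge_rank_onto e).

Lemma edge_dartK : cancel edge_dart edge_rank.
Proof. by move=> e; apply/eqP/(xchooseP (edge_rank_onto e)). Qed.

Lemma sum_edge_darts (V : nmodType) (F : dart G -> V) :
  \sum_e (F (edge_dart e) + F (rev_dart (edge_dart e))) = \sum_d F d.
Proof.
rewrite [RHS](partition_big edge_rank xpredT) //=; apply: eq_bigr => e _.
rewrite (eq_bigl (mem [set edge_dart e; rev_dart (edge_dart e)])) => [|d] /=; last first.
  by rewrite -[in LHS](edge_dartK e) eq_edge_rank !inE.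
by rewrite big_setU1 ?big_set1 // inE eq_sym rev_dart_neq.
Qed.

(* With [x := tail_rank] this is the vertex-edge incidence matrix, with
   [x := face_rank] the face-edge one, i.e. the incidence matrix of the dual. *)
Definition incidence_mx (p : nat) (x : dart G -> 'I_p) : 'M['F_2]_(p, #|edges G|) :=
  \matrix_(i, e) ((i == x (edge_dart e))%:R + (i == x (rev_dart (edge_dart e)))%:R).

Lemma incidence_mxE (p : nat) (x : dart G -> 'I_p) i d :
  incidence_mx x i (edge_rank d) = (i == x d)%:R + (i == x (rev_dart d))%:R.
Proof.
have : edge_rank (edge_dart (edge_rank d)) == edge_rank d by rewrite edge_dartK.
by rewrite eq_edge_rank mxE => /orP[] /eqP->; rewrite // rev_dartK addrC.
Qed.

Lemma mulmx_incidence (p : nat) (x : dart G -> 'I_p) (u : 'rV_p) d :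
  (u *m incidence_mx x) 0 (edge_rank d) = u 0 (x d) + u 0 (x (rev_dart d)).
Proof.
have sum_delta (j : 'I_p) : \sum_i u 0 i * (i == j)%:R = u 0 j.
  rewrite (bigD1 j) //= eqxx mulr1 big1 ?addr0 // => i /negPf->.
  by rewrite mulr0.
rewrite mxE; under eq_bigr do rewrite incidence_mxE mulrDr.
by rewrite big_split !sum_delta.
Qed.

Lemma incidence_mulmx (p n : nat) (x : dart G -> 'I_p) (M : 'M_(_, n)) i j :
  (incidence_mx x *m M) i j = \sum_(d | x d == i) M (edge_rank d) j.
Proof.
rewrite mxE [RHS]big_mkcond -sum_edge_darts; apply: eq_bigr => e _ /=.
by rewrite mxE edge_rank_rev edge_dartK ![_ == i]eq_sym mulrDl; do 2!case: eqP => _;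
  rewrite ?mul1r ?mul0r.
Qed.

Lemma leq_rank_incidence (p : nat) (x : dart G -> 'I_p) :
  (forall i, exists d, x d = i) ->
  (forall d, x (rotation d) = x d) \/ (forall d, x (phi d) = x d) ->
  (p <= (\rank (incidence_mx x)).+1)%N.
Proof.
move=> x_onto x_inv; apply: leq_rank_constant_ker => u /rowP u0.
suff const d : u 0 (x d) = u 0 (x d0).
  by move=> i j; have [di <-] := x_onto i; have [dj <-] := x_onto j; rewrite !const.
have u_rev d' : u 0 (x (rev_dart d')) = u 0 (x d').
  by apply/esym/F2_add_eq0; rewrite -mulmx_incidence u0 mxE.
move: d; apply: (dart_ind (d0 := d0)) => [//|d <- | d <-]; first exact: u_rev.
case: x_inv => x_inv; first by rewrite x_inv.
by rewrite -{1}[d]rev_dartK -face_permE x_inv u_rev.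
Qed.

Lemma face_incidence_orthogonal :
  incidence_mx face_rank *m (incidence_mx tail_rank)^T = 0.
Proof.
apply/matrixP => f v; rewrite incidence_mulmx mxE.
under eq_bigr do rewrite mxE incidence_mxE.
rewrite big_split /= [X in X + _](reindex_inj (@perm_inj _ phi)) /=.
rewrite (eq_bigl (fun d => face_rank d == f)) => [|d]; last first.
  by have [d' <-] := face_rank_onto f; rewrite !eq_face_rank face_next.
under eq_bigr do rewrite /tail_rank tail_face_perm.
rewrite -big_split big1 //= => d _.
exact: addrr_pchar2 (pchar_Fp (isT : prime 2)) _.
Qed.

Lemma leq_edges_rank_incidence :
  (#|edges G| <= \rank (incidence_mx tail_rank) + \rank (incidence_mx face_rank))%N.
Proof.
have tail_leq : (#|G| <= (\rank (incidence_mx tail_rank)).+1)%N.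
  apply: leq_rank_incidence tail_rank_onto _; left=> d.
  by rewrite /tail_rank tail_rotation.
have face_leq : (#|faces G| <= (\rank (incidence_mx face_rank)).+1)%N.
  apply: leq_rank_incidence face_rank_onto _; right=> d.
  by apply/eqP; rewrite eq_face_rank face_next.
have euler : (#|G| + #|faces G| = #|edges G| + 2)%N := plane_euler G.
by rewrite -(leq_add2r 2) -euler -[2%N]/(1 + 1)%N addnACA leq_add ?addn1.
Qed.

End Homology.

Lemma even_faces_bipartite (G : plane_graph) :
  (forall f, f \in faces G -> ~~ odd #|f|) -> bipartite G.
Proof.
move=> evenG; case: (pickP (fun _ : dart G => true)) => [d0 _ | no_dart]; last first.
  by exists (fun=> true) => x y xy; have := no_dart (mk_dart xy).
pose ones : 'rV['F_2]_#|edges G| := const_mx 1%R.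
have /submxP[c /rowP cE] : (ones <= incidence_mx (@tail_rank G))%MS.
  apply: sub_rowspace_of_orthogonal (face_incidence_orthogonal G) _ _.
    exact: leq_edges_rank_incidence.
  apply/colP => f; rewrite incidence_mulmx mxE.
  under eq_bigr do rewrite !mxE.
  rewrite sumr_const; apply/eqP; rewrite F2_natr_eq0.
  have -> : #|[pred d | face_rank d == f]| = #|(enum_val f : {set dart G})|.
    apply: eq_card => d; have [d' <-] := face_rank_onto f.
    by rewrite inE eq_face_rank eq_porbit_mem enum_rankK_in ?face_in_faces.
  exact/evenG/enum_valP.
exists (fun x => c 0 (enum_rank x) != 0)%R => x y xy.
have := cE (edge_rank (mk_dart xy)); rewrite mulmx_incidence mxE => one.
by rewrite negb_eqb -F2_add_neq0 -one.
Qed.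

(** * Turns in a cubic plane graph *)

Lemma eq_iter_porbit (T : finType) (s : {perm T}) (x : T) (k : nat) :
  (iter k s x == x) = (#|porbit s x| %| k).
Proof.
set n := #|porbit s x|; have n_gt0 : 0 < n by rewrite lt0n card_porbit_neq0.
rewrite {1}(divn_eq k n) addnC iterD.
have -> : iter (k %/ n * n) s x = x.
  by rewrite iterM; elim: (k %/ n) => //= q ->; apply: iter_porbit.
have := uniq_traject_porbit s x; rewrite -/n /dvdn => /uniqP.
move=> /(_ x (k %% n) 0); rewrite !inE size_traject ltn_mod n_gt0.
rewrite !nth_traject ?ltn_mod // => inj.
by apply/eqP/eqP => [/inj | ->] //; apply.
Qed.

Section Turns.
Variable G : plane_graph.
Hypothesis cubicG : cubic G.
Local Notation rotation := (Defs.rot G).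
Implicit Types (d : dart G) (left : bool) (w : seq bool).

(* [turn true] is [face_perm]: always turning left follows the face on the left. *)
Definition turn left : {perm dart G} :=
  (perm (@rev_dart_inj G) * (if left then rotation else rotation^-1))%g.

Lemma turnE left d :
  turn left d = (if left then rotation else rotation^-1)%g (rev_dart d).
Proof. by rewrite permM permE. Qed.

Lemma tail_turn left d : tail (turn left d) = dart_head d.
Proof.
rewrite turnE; case: left; first by rewrite tail_rotation.
by rewrite -(tail_rotation ((rotation^-1)%g _)) permKV.
Qed.

Lemma turn_rev_turnN left d : turn left (rev_dart (turn (~~ left) d)) = rev_dart d.
Proof. by rewrite !turnE rev_dartK; case: left; rewrite /= ?permK ?permKV. Qed.

Lemma card_porbit_rot d : #|porbit rotation d| = 3.
Proof. by rewrite rotP card_darts_at cubicG. Qed.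

Lemma rotation3 d : rotation (rotation (rotation d)) = d.
Proof. by have := iter_porbit rotation d; rewrite card_porbit_rot. Qed.

Lemma rotation_inv d : (rotation^-1)%g d = rotation (rotation d).
Proof. by apply: (canLR (permK _)); rewrite rotation3. Qed.

Lemma rotation_neq d : rotation d != d.
Proof. by rewrite (eq_iter_porbit rotation d 1) card_porbit_rot. Qed.

Lemma turn_rev_turn left d : turn left (rev_dart (turn left d)) = turn (~~ left) d.
Proof. by rewrite !turnE rev_dartK; case: left; rewrite /= !rotation_inv ?rotation3. Qed.

Lemma turn_neq_rev left d : turn left d != rev_dart d.
Proof.
rewrite turnE; case: left; first exact: rotation_neq.
by rewrite -(inj_eq (@perm_inj _ rotation)) permKV eq_sym rotation_neq.
Qed.

Lemma turn_left_neq_right d : turn true d != turn false d.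
Proof. by rewrite !turnE rotation_inv eq_sym rotation_neq. Qed.

Lemma turn_side_inj d : injective (fun left => turn left d).
Proof. by move=> [] [] //= E; have := turn_left_neq_right d; rewrite E eqxx. Qed.

Lemma turn_exists d d' :
  tail d' = dart_head d -> d' != rev_dart d -> exists left, d' = turn left d.
Proof.
move=> dd' nbacktrack; have : d' \in porbit rotation (rev_dart d).
  by rewrite rotP inE dd' tail_rev_dart.
rewrite porbit_traject card_porbit_rot !inE (negPf nbacktrack) /=.
by case/orP=> /eqP->; [exists true | exists false]; rewrite turnE ?rotation_inv.
Qed.

Lemma iter_turn_rev k left d :
  iter k (turn left) (rev_dart (iter k (turn (~~ left)) d)) = rev_dart d.
Proof. by elim: k => // k IH; rewrite iterSr iterS turn_rev_turnN. Qed.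

Lemma eq_iter_turn_rev k left d :
  (iter k (turn left) (rev_dart d) == rev_dart d) = (iter k (turn (~~ left)) d == d).
Proof.
apply/eqP/eqP => loop; last by rewrite -{1}loop iter_turn_rev.
by have := iter_turn_rev k (~~ left) (rev_dart d); rewrite negbK loop !rev_dartK.
Qed.

Definition walk w d : dart G := foldl (fun d left => turn left d) d w.

Lemma walk_rev w d : walk (rev (map negb w)) (rev_dart (walk w d)) = rev_dart d.
Proof.
elim: w d => //= left w IH d.
rewrite rev_cons -cats1 /walk foldl_cat [foldl _ _ (rev _)]IH /=.
by rewrite -{2}[left]negbK turn_rev_turnN.
Qed.

Definition closable w : Prop := exists d, walk w d = d.

Lemma closable_rev w : closable w -> closable (rev (map negb w)).
Proof. by case=> d wd; exists (rev_dart d); rewrite -{1}wd walk_rev. Qed.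

Lemma closable_rot k w : closable w -> closable (rot k w).
Proof.
case=> d wd; exists (walk (take k w) d); rewrite /rot.
rewrite /walk foldl_cat -[foldl _ _ (drop _ _)]foldl_cat cat_take_drop.
by rewrite [foldl _ _ w]wd.
Qed.

End Turns.

Arguments turn {G}.

(** * Four-cycles are facial *)

Section FourCycles.
Variable G : plane_graph.
Hypothesis cubicG : cubic G.
Hypothesis facesG :
  forall F, F \in faces G -> bounded_by_cycle 4 F || bounded_by_cycle 6 F.
Local Notation L := (@turn G true).
Local Notation R := (@turn G false).
Local Notation face := (porbit (face_perm (Defs.rot G))).
Implicit Types (d : dart G) (w : seq bool).

Lemma card_face d : (#|face d| == 4) || (#|face d| == 6).
Proof.
by case/orP: (facesG (face_in_faces d)) => /andP[-> _]; rewrite ?orbT.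
Qed.

Lemma eq_iter_left k d : (iter k L d == d) = (#|face d| %| k).
Proof. exact: eq_iter_porbit. Qed.

Lemma face_closes d : iter 4 L d = d \/ iter 6 L d = d.
Proof.
by case/orP: (card_face d) => /eqP fd; [left | right]; apply/eqP;
  rewrite eq_iter_left fd.
Qed.

Lemma left_left_neq d : L (L d) != d.
Proof. by rewrite (eq_iter_left 2); case/orP: (card_face d) => /eqP->. Qed.

Lemma tail_inj_face d d' : face d = face d' -> tail d = tail d' -> d = d'.
Proof.
move=> ff'; have tail_inj : {in face d &, injective (@tail G)}.
  by apply/imset_injP; case/orP: (facesG (face_in_faces d)) => /andP[/eqP -> /eqP->].
by apply: tail_inj; rewrite ?porbit_id // ff' porbit_id.
Qed.

Lemma face_iter_left k d : face (iter k L d) = face d.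
Proof. by elim: k => //= k <-; apply: face_next. Qed.

(* The darts met by left turns from Z are closed under all moves, hence, by
   connectedness, are all the darts. *)
Lemma hexagonal_tube_spans (Z : dart G -> Prop) d0 : Z d0 ->
  (forall d, Z d -> iter 6 L d = d) -> (forall d, Z d -> Z (iter 3 L d)) ->
  (forall d, Z d -> Z (rev_dart d)) ->
  (forall d, Z d -> exists2 d', Z d' & rev_dart (L d) = L d') ->
  (forall d, Z d -> exists2 d', Z d' & rev_dart (L (L d)) = L (L d')) ->
  forall d, iter 6 L d = d.
Proof.
move=> Zd0 Zhex Z3 Zrev ZrevL ZrevLL.
pose tube d := exists k, exists2 z, Z z & d = iter k L z.
have tube_left d : tube d -> tube (L d) by case=> k [z Zz ->]; exists k.+1, z.
have tube_rev d : tube d -> tube (rev_dart d).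
  case=> k [z Zz ->]; rewrite (divn_eq k 3) addnC iterD.
  have {}Zz : Z (iter (k %/ 3 * 3) L z).
    by rewrite iterM; elim: (k %/ 3) => //= q /Z3.
  move: (iter _ _ z) Zz => {}z Zz; have : k %% 3 < 3 by rewrite ltn_mod.
  case: (k %% 3) => [|[|[|//]]] _ /=.
  - by exists 0, (rev_dart z); first exact: Zrev.
  - by have [z' Zz' ->] := ZrevL z Zz; exists 1, z'.
  - by have [z' Zz' ->] := ZrevLL z Zz; exists 2, z'.
move=> d; suff [k [z Zz ->]] : tube d by rewrite -iterD addnC iterD Zhex.
move: d; apply: (dart_ind (d0 := d0)); [by exists 0, d0 | exact: tube_rev | move=> d].
by move/tube_rev/tube_left; rewrite turnE rev_dartK.
Qed.

Lemma not_closed_LLLR d : walk [:: true; true; true; false] d <> d.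
Proof.
move=> /= loop; have := turn_left_neq_right cubicG (iter 3 L d).
rewrite [R _]loop; case/eqP; apply: tail_inj_face (face_iter_left 4 d) _.
by rewrite -[in RHS]loop !tail_turn.
Qed.

Definition closed_LLRR d : Prop := walk [:: true; true; false; false] d = d.

Lemma closed_LLRR_hexagon d : closed_LLRR d -> iter 6 L d = d.
Proof.
move=> /= loop; case: (face_closes d) => // square.
have := turn_left_neq_right cubicG (L (L d)); case/eqP; apply: dart_eq.
  by rewrite !tail_turn.
by rewrite -(tail_turn true) -[dart_head (R _)](tail_turn false) [L _]square [R _]loop.
Qed.

Lemma closed_LLRR_rev d : closed_LLRR d -> closed_LLRR (rev_dart d).
Proof.
by move=> loop; have := walk_rev [:: true; true; false; false] d; rewrite loop.
Qed.

(* Three sides of the hexagon lie on the cycle, the other three, from L^3 d on, lie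
   on the next 4-cycle of the tube. *)
Lemma closed_LLRR_left3 d : closed_LLRR d -> closed_LLRR (iter 3 L d).
Proof.
move=> loop; have hex := closed_LLRR_hexagon loop; rewrite /closed_LLRR /= in loop *.
rewrite -[R (L _)](turn_rev_turn cubicG true) [L (L (L (L (L (L d)))))]hex.
by rewrite -{1}loop (turn_rev_turnN true) (turn_rev_turn cubicG false).
Qed.

Lemma closed_LLRR_rev_left d : closed_LLRR d ->
  rev_dart (L (rev_dart d)) = L (rev_dart (iter 3 L d)).
Proof.
move=> /= loop; rewrite -{1}loop (turn_rev_turnN true) rev_dartK.
by rewrite (turn_rev_turn cubicG true).
Qed.

Lemma closed_LLRR_rev_left2 d : closed_LLRR d -> rev_dart (L (L d)) = L (L (rev_dart d)).
Proof. by move=> /= loop; rewrite -{2}loop !(turn_rev_turnN true). Qed.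

Definition closed_LRLR d : Prop := walk [:: true; false; true; false] d = d.

Lemma closed_LRLR_right_left d : closed_LRLR d -> closed_LRLR (R (L d)).
Proof. by rewrite /closed_LRLR /= => ->. Qed.

Lemma closed_LRLR_rev d : closed_LRLR d -> closed_LRLR (rev_dart d).
Proof.
by move=> loop; have := walk_rev [:: true; false; true; false] d; rewrite loop.
Qed.

Lemma rev_last_left k d : iter k.+1 L (R (L d)) = R (L d) ->
  rev_dart (iter k L (R (L d))) = L (L d).
Proof.
move=> /= loop; rewrite -(turn_rev_turnN false) loop.
by rewrite (turn_rev_turn cubicG false).
Qed.

Lemma closed_LRLR_hexagon d : closed_LRLR d -> iter 6 L d = d.
Proof.
move=> loop; case: (face_closes d) => // square.
have left3 : iter 3 L (R (L d)) = R (L (L d)).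
  have := @rev_last_left 3 (R (L d)); rewrite [R (L (R _))]loop => /(_ square) /= <-.
  exact: turn_rev_turn.
case: (face_closes (R (L d))) => /rev_last_left /(canRL (@rev_dartK G)) last.
  by case/eqP: (turn_neq_rev cubicG false (L (L d))); rewrite -left3.
case/eqP: (left_left_neq (iter 3 L (R (L d)))); apply: tail_inj_face.
  exact: (face_iter_left 2).
by rewrite [L (L _)]last left3 tail_turn.
Qed.

(* The hexagons on the left of d and of R (L d) contribute two sides each to the
   next 4-cycle of the tube. *)
Lemma closed_LRLR_left3 d : closed_LRLR d -> closed_LRLR (iter 3 L d).
Proof.
suff opposite d' : closed_LRLR d' -> closed_LRLR (iter 3 L (R (L d'))).
  by move=> loop; have := opposite _ (closed_LRLR_right_left loop); rewrite [R _]loop.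
move=> {d} loop; have loop' := closed_LRLR_right_left loop.
have last := rev_last_left (closed_LRLR_hexagon loop').
have last' : rev_dart (iter 5 L d') = L (L (R (L d'))).
  have := @rev_last_left 5 (R (L d')); rewrite [R (L (R _))]loop.
  by move/(_ (closed_LRLR_hexagon loop)).
rewrite /closed_LRLR /=.
rewrite -[R (L (L (L (L _))))](turn_rev_turn cubicG true) [rev_dart _]last.
by rewrite -[R (L (L (L (L _))))](turn_rev_turn cubicG true) [rev_dart _]last'.
Qed.

Lemma closed_LRLR_rev_left2 d : closed_LRLR d ->
  rev_dart (L (L d)) = L (L (iter 3 L (R (L d)))).
Proof.
by move/closed_LRLR_right_left/closed_LRLR_hexagon/rev_last_left <-; rewrite rev_dartK.
Qed.

Hypothesis squareG : exists d, #|face d| = 4.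

Lemma not_all_hexagons : ~ forall d, iter 6 L d = d.
Proof. by case: squareG => d d4 /(_ d) /eqP; rewrite eq_iter_left d4. Qed.

Lemma not_closed_LLRR d : ~ closed_LLRR d.
Proof.
move=> loop; apply/not_all_hexagons/(hexagonal_tube_spans loop).
- exact: closed_LLRR_hexagon.
- exact: closed_LLRR_left3.
- exact: closed_LLRR_rev.
- move=> z /closed_LLRR_rev Zz; exists (rev_dart (iter 3 L (rev_dart z))).
    exact/closed_LLRR_rev/closed_LLRR_left3.
  by rewrite -closed_LLRR_rev_left // rev_dartK.
- move=> z Zz; exists (rev_dart z); first exact: closed_LLRR_rev.
  exact: closed_LLRR_rev_left2.
Qed.

Lemma not_closed_LRLR d : ~ closed_LRLR d.
Proof.
move=> loop; apply/not_all_hexagons/(hexagonal_tube_spans loop).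
- exact: closed_LRLR_hexagon.
- exact: closed_LRLR_left3.
- exact: closed_LRLR_rev.
- move=> z Zz; exists (rev_dart (R (L z))).
    exact/closed_LRLR_rev/closed_LRLR_right_left.
  by rewrite (turn_rev_turnN true).
- move=> z Zz; exists (iter 3 L (R (L z))); last exact: closed_LRLR_rev_left2.
  exact/closed_LRLR_left3/closed_LRLR_right_left.
Qed.

Lemma closed_walk4_constant w d : size w = 4 -> walk w d = d -> constant w.
Proof.
move=> size_w loop; have w_closable : closable G w by exists d.
pose bad := [:: [:: true; true; true; false]; [:: true; true; false; false];
                [:: true; false; true; false]].
have not_bad v : closable G v -> v \notin bad.
  case=> e ev; apply/negP; rewrite !inE => /or3P[] /eqP vE; move: ev; rewrite vE.
  - exact: not_closed_LLLR.
  - exact: not_closed_LLRR.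
  - exact: not_closed_LRLR.
have up_to_symmetry : constant w
    || has (fun k => (rot k w \in bad) || (rot k (rev (map negb w)) \in bad)) (iota 0 4).
  move: w size_w {loop w_closable} => [|b1 [|b2 [|b3 [|b4 [|]]]]] //= _.
  by case: b1; case: b2; case: b3; case: b4.
case/orP: up_to_symmetry => // /hasP[k _]; rewrite !(negPf (not_bad _ _)) //.
  exact/closable_rot/closable_rev.
exact: closable_rot.
Qed.

Lemma mk_dart_turn (x y z : G) (xy : adj x y) (yz : adj y z) :
  x != z -> exists left, mk_dart yz = turn left (mk_dart xy).
Proof.
move=> xz; apply: (turn_exists cubicG) => //.
by apply: contraNneq xz => /(congr1 (@dart_head G)); rewrite /dart_head /= => ->.
Qed.

Lemma four_cycle_turns (a b c d : G) (ab : adj a b) (bc : adj b c) (cd : adj c d)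
    (da : adj d a) : a != c -> b != d ->
  exists left,
    [/\ mk_dart bc = turn left (mk_dart ab), mk_dart cd = turn left (mk_dart bc),
        mk_dart da = turn left (mk_dart cd) & mk_dart ab = turn left (mk_dart da)].
Proof.
move=> ac bd; have [ca db] : c != a /\ d != b by split; rewrite eq_sym.
have [at_b bcE] := mk_dart_turn ab bc ac; have [at_c cdE] := mk_dart_turn bc cd bd.
have [at_d daE] := mk_dart_turn cd da ca; have [at_a abE] := mk_dart_turn da ab db.
have := @closed_walk4_constant [:: at_b; at_c; at_d; at_a] (mk_dart ab) erefl.
rewrite /= -bcE -cdE -daE -abE => /(_ erefl) /and4P[/eqP c_b /eqP d_b /eqP a_b _].
by exists at_b; rewrite -{2}c_b -{2}d_b -{2}a_b.
Qed.

Lemma turn_mk_dart left (x y : G) (xy : adj x y) :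
  exists z (yz : adj y z), x != z /\ mk_dart yz = turn left (mk_dart xy).
Proof.
set d := mk_dart xy; have dy : tail (turn left d) = y by apply: tail_turn.
have yz : adj y (dart_head (turn left d)) by rewrite -{1}dy adj_dart.
exists _, yz; split; last exact: dart_eq.
apply: contraNneq (turn_neq_rev cubicG left d) => xE; exact/eqP/dart_eq.
Qed.

(* With p, q and r the neighbours of x in cyclic order, the 4-cycles y p x q and
   y p x r would turn in opposite directions at x, hence also at p. *)
Lemma four_cycles_K23_free : K23_free G.
Proof.
move=> x y xy; rewrite leqNgt; apply/negP => common3.
have y_nbr z : adj x z -> adj z y.
  have /eqP/setP/(_ z) : neighbours x :&: neighbours y == neighbours x.
    by rewrite eqEcard subsetIl cubicG.
  by rewrite !inE => E xz; move: E; rewrite xz adj_sym => /= ->.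
have [p xp] : exists p, adj x p.
  have /card_gt0P[p] : 0 < #|neighbours x| by rewrite cubicG.
  by rewrite inE; exists p.
have px : adj p x by rewrite adj_sym.
have yp : adj y p by rewrite adj_sym y_nbr.
have turn_at_p left : mk_dart px = turn left (mk_dart yp).
  have [q [xq [pq qE]]] := turn_mk_dart left px.
  have yx : y != x by rewrite eq_sym.
  have [left' [pxE xqE _ _]] := four_cycle_turns yp px xq (y_nbr _ xq) yx pq.
  by rewrite pxE -(turn_side_inj cubicG (etrans (esym qE) xqE)).
by have := turn_left_neq_right cubicG (mk_dart yp); rewrite -!turn_at_p eqxx.
Qed.

Variable x0 : G.

Definition square_placement (p : bool * dart G) : 4.-tuple G :=
  let d k := iter k (turn p.1) p.2 in
  [tuple tail (d 0); tail (d 1); tail (d 2); tail (d 3)].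

Definition facial_walks : {set bool * dart G} :=
  [set p | iter 4 (turn p.1) p.2 == p.2].

Lemma square_placement_inj : injective square_placement.
Proof.
move=> [left d] [left' d'] /(congr1 val) /= [t0 + + _]; rewrite !tail_turn => t1 t2.
have dd' : d = d' by apply: dart_eq.
rewrite -dd' in t2 *; congr pair; apply: (turn_side_inj cubicG (d := d)).
by apply: dart_eq; rewrite ?tail_turn.
Qed.

Lemma placement_C4_facial (t : 4.-tuple G) :
  placement x0 C4_pattern t = (t \in square_placement @: facial_walks).
Proof.
apply/idP/imsetP => [|[[left d]]]; last first.
  rewrite inE /= => /eqP loop ->; rewrite /placement /= !inE !negb_or !andbT.
  have step_adj (e : dart G) : adj (tail e) (tail (turn left e)).
    by rewrite tail_turn adj_dart.
  have skip_neq (e : dart G) : tail e != tail (turn left (turn left e)).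
    apply: contraNneq (turn_neq_rev cubicG left e) => tail_eq; apply/eqP/dart_eq.
      by rewrite tail_turn.
    by rewrite dart_head_rev tail_eq tail_turn.
  have last_adj := step_adj (iter 3 (turn left) d); rewrite /= loop in last_adj.
  by rewrite !step_adj last_adj !skip_neq !adj_neq // adj_sym.
case/tupleP: t => a t; case/tupleP: t => b t; case/tupleP: t => c t.
case/tupleP: t => d t; rewrite (tuple0 t) /placement /= !inE !negb_or !andbT.
case/andP=> /and3P[/and3P[_ ac _] /andP[_ bd] _] /and4P[ab bc cd da].
have [left [bcE cdE daE abE]] := four_cycle_turns ab bc cd da ac bd.
exists (left, mk_dart ab); first by rewrite inE /= -bcE -cdE -daE -abE.
by apply: val_inj; rewrite /= -bcE -cdE -daE.
Qed.

Lemma card_facial_walks :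
  #|facial_walks| = 2 * #|[set d | #|face d| == 4]|.
Proof.
rewrite -sum1_card (eq_bigl (fun p => xpredT p.1 && (iter 4 (turn p.1) p.2 == p.2)));
  last by move=> p; rewrite inE.
rewrite -(pair_big_dep xpredT (fun left (d : dart G) => iter 4 (turn left) d == d)
  (fun _ _ => 1)) big_bool /=.
rewrite [X in _ + X](reindex_inj (@rev_dart_inj G)) /=.
rewrite [X in _ + X](eq_bigl _ _ (fun d => eq_iter_turn_rev 4 false d)) addnn -mul2n.
rewrite sum1dep_card; congr (2 * _); apply: eq_card => d.
by rewrite !inE (eq_iter_left 4); case/orP: (card_face d) => /eqP->.
Qed.

End FourCycles.

(** * Counting matchings *)

Lemma card_porbit_eq (T : finType) (s : {perm T}) (k : nat) :
  #|[set x | #|porbit s x| == k]| = k * #|[set O in porbits s | #|O| == k]|.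
Proof.
rewrite -sum1_card (partition_big (porbit s) (mem [set O in porbits s | #|O| == k])) /=.
  rewrite mulnC -sum_nat_const; apply: eq_bigr => O.
  rewrite inE => /andP[/imsetP[x _ ->] /eqP <-]; rewrite sum1_card; apply: eq_card => y.
  rewrite -topredE /= inE eq_porbit_mem; apply: andb_idl.
  by rewrite -eq_porbit_mem => /eqP->.
by move=> x; rewrite !inE imset_f.
Qed.

Section Fullerene.
Variables (G : plane_graph) (h : nat).
Hypotheses (fullG : is_46fullerene G) (hexG : num_faces G 6 = h).
Local Notation face := (porbit (face_perm (Defs.rot G))).

Lemma card_darts_of_face_size k : (k == 4) || (k == 6) ->
  #|[set d : dart G | #|face d| == k]| = k * num_faces G k.
Proof.
have [_ facesG _] := fullG; move=> k46; rewrite card_porbit_eq; congr (_ * _).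
apply: eq_card => F; rewrite !inE; apply: andb_id2l => /facesG.
rewrite /bounded_by_cycle.
by case/orP: k46 => /eqP-> /orP[] /andP[/eqP-> F_tails]; rewrite ?F_tails.
Qed.

Lemma card_square_darts : #|[set d : dart G | #|face d| == 4]| = 24.
Proof. by have [_ _ six] := fullG; rewrite card_darts_of_face_size // six. Qed.

Lemma card_fullerene : #|G| = 2 * h + 8.
Proof.
have [cubicG facesG _] := fullG; have := card_darts cubicG.
rewrite -(cardC (mem [set d : dart G | #|face d| == 4])) card_square_darts.
have -> : #|[predC [set d : dart G | #|face d| == 4]]| = 6 * h.
  rewrite -hexG -card_darts_of_face_size //; apply: eq_card => d; rewrite !inE.
  by case/orP: (card_face facesG d) => /eqP->.
by move: #|G| => n; lia.
Qed.

Lemma exists_square_dart : exists d : dart G, #|face d| = 4.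
Proof.
have /card_gt0P[d] : 0 < #|[set d : dart G | #|face d| == 4]|.
  by rewrite card_square_darts.
by rewrite inE => /eqP; exists d.
Qed.

Lemma fullerene_bipartite : bipartite G.
Proof.
have [_ facesG _] := fullG; apply: even_faces_bipartite => F /facesG.
by case/orP=> /andP[/eqP->].
Qed.

Lemma num_placements_C4_fullerene (x0 : G) : num_placements x0 4 C4_pattern = 48.
Proof.
have [cubicG facesG _] := fullG; rewrite /num_placements.
under eq_bigr do rewrite (placement_C4_facial cubicG facesG exists_square_dart).
rewrite -big_mkcond sum1_card card_imset; last exact: square_placement_inj.
by rewrite card_facial_walks // card_square_darts.
Qed.

Local Open Scope ring_scope.

Lemma fullerene_matchings :
  let x := h%:Z in
  [/\ 8 * (num_matchings G 4)%:Z =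
        27 * x ^+ 4 + 162 * x ^+ 3 + 273 * x ^+ 2 + 234 * x + 72,
      40 * (num_matchings G 5)%:Z =
        81 * x ^+ 5 + 270 * x ^+ 4 - 45 * x ^+ 3 + 390 * x ^+ 2 - 216 * x
    & 240 * (num_matchings G 6)%:Z =
        243 * x ^+ 6 - 243 * x ^+ 5 - 1485 * x ^+ 4 + 6075 * x ^+ 3 - 16998 * x ^+ 2
        - 2952 * x - 3840 + 40 * (num_subgraphs graphQ G)%:Z].
Proof.
move=> x; have [cubicG facesG _] := fullG.
have squareG := exists_square_dart; have [d _] := squareG.
have := num_placements_cubic_bipartite (tail d) cubicG fullerene_bipartite
  (four_cycles_K23_free cubicG facesG squareG).
rewrite num_placements_C4_fullerene card_fullerene num_placements_Q.
rewrite (num_placements_matching _ 4) (num_placements_matching _ 5).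
rewrite (num_placements_matching _ 6).
have [-> -> ->] : [/\ 2 ^ 4 * 4`! = 384, 2 ^ 5 * 5`! = 3840 & 2 ^ 6 * 6`! = 48 * 960]%N.
  by [].
move: (num_matchings G 4) (num_matchings G 5) (num_matchings G 6) (num_subgraphs _ _).
move: (num_placements _ _ _) => N6 M4 M5 M6 NQ [M4E M5E M6E QE].
rewrite /Z.pow /Z.pow_pos /= {}/x in M4E M5E M6E QE *.
by split; lia.
Qed.

End Fullerene.

Local Open Scope ring_scope.

Theorem theorem3p7 (G : plane_graph) (h : nat)
    (fullG : is_46fullerene G) (hexG : num_faces G 6 = h) :
  let x : rat := h%:R in
  [/\ (num_matchings G 4)%:R =
        27 / 8 * x ^+ 4 + 81 / 4 * x ^+ 3 + 273 / 8 * x ^+ 2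
        + 117 / 4 * x + 9 :> rat,
      (num_matchings G 5)%:R =
        81 / 40 * x ^+ 5 + 27 / 4 * x ^+ 4 - 9 / 8 * x ^+ 3
        + 39 / 4 * x ^+ 2 - 27 / 5 * x :> rat
    & (num_matchings G 6)%:R =
        81 / 80 * x ^+ 6 - 81 / 80 * x ^+ 5 - 99 / 16 * x ^+ 4
        + 405 / 16 * x ^+ 3 - 2833 / 40 * x ^+ 2 - 123 / 10 * x - 16
        + (num_subgraphs graphQ G)%:R / 6 :> rat].
Proof.
have to_rat (m n : int) : m = n -> m%:~R = n%:~R :> rat by move->.
have [/to_rat M4E /to_rat M5E /to_rat M6E] := fullerene_matchings fullG hexG.
by move=> x; split; lra.
Qed.
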